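(* Every category $\mathcal{E}$ enriched in the monoidal category $\mathcal{R}_\bot$ is Cauchy complete.
   Context: The symmetric closed monoidal category $\mathcal{R}_\bot$ is the totally ordered set $\{\bot\}\cup[0,\infty)\cup\{\infty\}$, with $\bot$ the least element, $\infty$ the greatest, and the usual order on $[0,\infty)$, viewed as a category with a unique arrow $a\to b$ iff $a\le b$. Its tensor product is $+$: for $a,b\in[0,\infty)$, $a+b$ is the usual sum; $\bot+x=x+\bot=\bot$ for every $x$ (including $x=\infty$); and $\infty+x=x+\infty=\infty$ for every $x\neq\bot$. The tensor unit is $0$. Colimits in $\mathcal{R}_\bot$ are suprema (the empty supremum is $\bot$). An $\mathcal{R}_\bot$-category $\mathcal{E}$ consists of objects and, for all objects $X,Y$, an element $\mathcal{E}(X,Y)\in\mathcal{R}_\bot$, such that $0\le\mathcal{E}(X,X)$ and $\mathcal{E}(X,Y)+\mathcal{E}(Y,Z)\le\mathcal{E}(X,Z)$ for all objects $X,Y,Z$. Let $\mathcal{I}$ be the unit $\mathcal{R}_\bot$-category (one object, with endohom $0$). A module $M:\mathcal{I}\nrightarrow\mathcal{E}$ is an assignment $X\mapsto M(X)\in\mathcal{R}_\bot$ with $\mathcal{E}(Y,X)+M(X)\le M(Y)$ for all $X,Y$. A module $N:\mathcal{E}\nrightarrow\mathcal{I}$ is an assignment $X\mapsto N(X)\in\mathcal{R}_\bot$ with $N(X)+\mathcal{E}(X,Y)\le N(Y)$ for all $X,Y$. $N$ is right adjoint to $M$ iff $0\le\sup_X\big(N(X)+M(X)\big)$ and $M(X)+N(Y)\le\mathcal{E}(X,Y)$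 for all $X,Y$. The module $M$ is called Cauchy if it has a right adjoint, and representable if there is an object $Z$ of $\mathcal{E}$ with $M(Y)=\mathcal{E}(Y,Z)$ for all $Y$. $\mathcal{E}$ is Cauchy complete if every Cauchy module $M:\mathcal{I}\nrightarrow\mathcal{E}$ is representable. *)

(* Defs.v *)
From HB Require Import structures.
From mathcomp Require Import all_boot all_order all_algebra.
From mathcomp Require Import all_classical all_reals ereal.

Set Implicit Arguments.
Unset Strict Implicit.
Unset Printing Implicit Defensive.

Import Order.TTheory GRing.Theory Num.Theory.

(* The value base {bot} u [0, oo) u {oo} is carried by {-oo} u [0, +oo] inside
   \bar R, with bot := -oo. The library convention -oo + +oo = -oo makes the
   addition of \bar R restrict to the tensor product, in which bot absorbs
   everything, +oo included; see tensorE below. *)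
Definition is_rbot (R : realType) : pred (\bar R) :=
  fun x => (x == -oo%E) || (0 <= x)%E.

Record rbot (R : realType) : Type := Rbot
  { rbot_val : \bar R;
    rbot_valP : is_rbot rbot_val }.

HB.instance Definition _ (R : realType) := [isSub for @rbot_val R].
HB.instance Definition _ (R : realType) := [Choice of rbot R by <:].

Fact rbot_display : Order.disp_t. Proof. exact: Order.Disp tt tt. Qed.

HB.instance Definition _ (R : realType) :=
  [SubChoice_isSubOrder of rbot R by <: with rbot_display].

Declare Scope rbot_scope.
Delimit Scope rbot_scope with rbot.
Bind Scope rbot_scope with rbot.

Notation "x <= y" := (@Order.le rbot_display (rbot _) x y) : rbot_scope.

Lemma rbot_leE (R : realType) (x y : rbot R) :
  (x <= y)%rbot = (rbot_val x <= rbot_val y)%E.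
Proof. by []. Qed.

Lemma is_rbot_ninfty (R : realType) : is_rbot (-oo%E : \bar R).
Proof. by rewrite /is_rbot eqxx. Qed.

Lemma is_rbot_ge0 (R : realType) (x : \bar R) : (0 <= x)%E -> is_rbot x.
Proof. by rewrite /is_rbot => ->; rewrite orbT. Qed.

Definition rbot_bot (R : realType) : rbot R := Rbot (is_rbot_ninfty R).
Definition rbot_unit (R : realType) : rbot R :=
  Rbot (is_rbot_ge0 (lexx (0%E : \bar R))).
Definition rbot_infty (R : realType) : rbot R :=
  Rbot (is_rbot_ge0 (leey (0%E : \bar R))).
Definition rbot_fin (R : realType) (r : R) (r0 : (0 <= r)%R) : rbot R :=
  Rbot (is_rbot_ge0 (r0 : (0 <= r%:E)%E)).

Arguments rbot_bot {R}.
Arguments rbot_unit {R}.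
Arguments rbot_infty {R}.

Lemma is_rbotD (R : realType) (x y : \bar R) :
  is_rbot x -> is_rbot y -> is_rbot (x + y)%E.
Proof.
move=> /orP[/eqP -> _|x0 /orP[/eqP ->|y0]].
- by rewrite addNye is_rbot_ninfty.
- by rewrite addeNy is_rbot_ninfty.
- by rewrite is_rbot_ge0// adde_ge0.
Qed.

Definition tensor (R : realType) (x y : rbot R) : rbot R :=
  Rbot (is_rbotD (rbot_valP x) (rbot_valP y)).

Notation "x + y" := (tensor x y) : rbot_scope.
Notation "0" := rbot_unit : rbot_scope.

Lemma is_rbot_sup (R : realType) (S : set (rbot R)) :
  is_rbot (ereal_sup [set rbot_val x | x in S]).
Proof.
have [S0|] := pselect (exists2 x, S x & (0 <= rbot_val x)%E).
  have [x Sx x0] := S0; apply: is_rbot_ge0; apply: le_trans x0 _.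
  by apply: ereal_sup_ubound; exists x.
move=> S0; rewrite /is_rbot; apply/orP; left; apply/eqP.
apply/ereal_sup_ninfty => _ [x Sx <-] /=.
by have /orP[/eqP //|x0] := rbot_valP x; case: S0; exists x.
Qed.

Definition rbot_sup (R : realType) (S : set (rbot R)) : rbot R :=
  Rbot (is_rbot_sup S).

Lemma rbot_supP (R : realType) (S : set (rbot R)) (y : rbot R) :
  (rbot_sup S <= y)%rbot <-> (forall x, S x -> (x <= y)%rbot).
Proof.
rewrite rbot_leE; split=> [Sy x Sx|Sy].
  by rewrite rbot_leE; apply: le_trans Sy; apply: ereal_sup_ubound; exists x.
by apply: ge_ereal_sup => _ [x Sx <-]; rewrite -rbot_leE; exact: Sy.
Qed.

Lemma rbot_caseP (R : realType) (x : rbot R) :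
  [\/ x = rbot_bot, exists (r : R) (r0 : (0 <= r)%R), x = rbot_fin r0
    | x = rbot_infty].
Proof.
case: x => -[r||] rP.
- apply: Or32; have r0 : (0 <= r)%R by move: rP; rewrite /is_rbot/= lee_fin.
  by exists r, r0; apply: val_inj.
- by apply: Or33; apply: val_inj.
- by apply: Or31; apply: val_inj.
Qed.

Lemma tensorE (R : realType) :
  [/\ forall x : rbot R, (rbot_bot + x)%rbot = rbot_bot,
      forall x : rbot R, (x + rbot_bot)%rbot = rbot_bot,
      forall x : rbot R, x <> rbot_bot -> (rbot_infty + x)%rbot = rbot_infty,
      forall x : rbot R, x <> rbot_bot -> (x + rbot_infty)%rbot = rbot_infty
    & forall (r s : R) (r0 : (0 <= r)%R) (s0 : (0 <= s)%R),
        (rbot_fin r0 + rbot_fin s0)%rbot = rbot_fin (addr_ge0 r0 s0)].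
Proof.
split.
- by move=> x; apply: val_inj; rewrite /= addNye.
- by move=> x; apply: val_inj; rewrite /= addeNy.
- move=> x; case: (rbot_caseP x) => [->//|[r [r0 ->]] _|-> _];
  exact: val_inj.
- move=> x; case: (rbot_caseP x) => [->//|[r [r0 ->]] _|-> _];
  exact: val_inj.
- by move=> r s r0 s0; apply: val_inj.
Qed.

Record rbot_category (R : realType) : Type := RbotCategory
  { Ob :> Type;
    ehom : Ob -> Ob -> rbot R;
    ehom_id : forall X : Ob, (0 <= ehom X X)%rbot;
    ehom_comp : forall X Y Z : Ob, (ehom X Y + ehom Y Z <= ehom X Z)%rbot }.

Arguments ehom {R r} X Y.

(* Modules I -|-> E and E -|-> I, for I the unit category; the action
   inequalities for the single hom 0 of I hold trivially. *)
Record module_from_unit (R : realType) (E : rbot_category R) : Type :=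
  ModuleFromUnit
  { mfu_val :> E -> rbot R;
    mfu_act : forall X Y : E, (ehom Y X + mfu_val X <= mfu_val Y)%rbot }.

Record module_to_unit (R : realType) (E : rbot_category R) : Type :=
  ModuleToUnit
  { mtu_val :> E -> rbot R;
    mtu_act : forall X Y : E, (mtu_val X + ehom X Y <= mtu_val Y)%rbot }.

Definition right_adjoint (R : realType) (E : rbot_category R)
    (M : module_from_unit E) (N : module_to_unit E) : Prop :=
  (0 <= rbot_sup (range (fun X : E => N X + M X)))%rbot /\
  (forall X Y : E, (M X + N Y <= ehom X Y)%rbot).

Definition cauchy_module (R : realType) (E : rbot_category R)
    (M : module_from_unit E) : Prop :=
  exists N : module_to_unit E, right_adjoint M N.

Definition representable (R : realType) (E : rbot_category R)
    (M : module_from_unit E) : Prop :=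
  exists Z : E, forall Y : E, M Y = ehom Y Z.

Definition cauchy_complete (R : realType) (E : rbot_category R) : Prop :=
  forall M : module_from_unit E, cauchy_module M -> representable M.

(* Main.v *)
Require Import Defs.
From mathcomp Require Import all_boot all_order all_algebra.
From mathcomp Require Import all_classical all_reals.

Set Implicit Arguments.
Unset Strict Implicit.
Unset Printing Implicit Defensive.

Import Order.TTheory.

(** In the value base nothing lies strictly between bot and the unit 0. Hence
    the unit inequality of an adjunction, a supremum that is at least 0, already
    gives one object Z with N Z + M Z different from bot
    ([rbot_sup_ge_unit_mem]), and since bot is absorbing, both N Z and M Z are
    then at least 0 ([tensor_ge_unit]). Tensoring with an element of value at least 0
    can only increase values ([le_tensorr]), so for every Y
      M Y <= M Y + N Z <= E(Y, Z) <= E(Y, Z) + M Z <= M Y,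
    by the counit inequality of the adjunction and the action of E on M.
    Thus Z represents M. *)

(** The gap between bot and 0 makes 0 inaccessible by suprema of smaller
    elements: a family with no member at or above 0 consists of copies of bot only. *)
Lemma rbot_sup_ge_unit_mem (R : realType) (S : set (rbot R)) :
  (0 <= rbot_sup S)%rbot -> exists2 x, S x & (0 <= x)%rbot.
Proof.
move=> S0; apply: contrapT => noS.
suff Sbot : (rbot_sup S <= rbot_bot)%rbot by have := le_trans S0 Sbot.
apply/rbot_supP => x Sx; rewrite rbot_leE.
have /orP[/eqP -> //|x0] := rbot_valP x.
by case: noS; exists x.
Qed.

Lemma tensor_ge_unit (R : realType) (x y : rbot R) :
  (0 <= x + y)%rbot -> (0 <= x)%rbot /\ (0 <= y)%rbot.
Proof.
rewrite !rbot_leE /=.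
have /orP[/eqP ->|x0] := rbot_valP x; first by rewrite addNye.
by have /orP[/eqP ->|y0] := rbot_valP y; first by rewrite addeNy.
Qed.

Lemma le_tensorr (R : realType) (x y : rbot R) :
  (0 <= y)%rbot -> (x <= x + y)%rbot.
Proof. by rewrite !rbot_leE; exact: leeDl. Qed.

Theorem proposition2p2 (R : realType) (E : rbot_category R) :
  cauchy_complete E.
Proof.
move=> M [N [unitMN counitMN]].
have [_ [Z _ <-] /tensor_ge_unit[NZ0 MZ0]] := rbot_sup_ge_unit_mem unitMN.
exists Z => Y; apply/le_anti/andP; split.
- exact: le_trans (le_tensorr _ NZ0) (counitMN Y Z).
- exact: le_trans (le_tensorr _ MZ0) (mfu_act M Z Y).
Qed.
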